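(* For every $n\ge1$ there is a bijection $\phi^{(B)}_C:\mathcal{CUD}^{(B)}_n\to\mathcal{T}^\circ_n$ which, for each $1\le k\le n$, restricts to a bijection from $\mathcal{CUD}^{(B)}_{n,k}$ onto $\mathcal{T}^\circ_{n,k}$.
   Context: A signed permutation of $[n]$ is a bijection $\sigma$ of $[\pm n]$ with $\sigma(-i)=-\sigma(i)$; $\bar a=-a$; cycles on $[\pm n]$ are written $(c_1,\dots,c_r)$ with $\sigma(c_j)=c_{j+1}$, $\sigma(c_r)=c_1$. $\mathcal{CUD}^{(B)}_n$: signed permutations with no cycle $C=-C$ such that, writing the cycle notation $(a_{1,1},a_{1,2},\dots)\cdots(a_{m,1},\dots)$ — one cycle from each pair $\{C,-C\}$, the one in which the entry of smallest absolute value is positive, written starting with that entry, with $a_{1,1}<\dots<a_{m,1}$ — each cycle satisfies $|a_{i,1}|<|a_{i,2}|>|a_{i,3}|<\cdots$. $\mathcal{CUD}^{(B)}_{n,k}$: those with $a_{m,1}=k$. $\mathcal{T}_n$ is the set of complete increasing binary trees with $n$ labelled nodes: plane rooted trees in which every node is either a leaf or has exactly two ordered children (left, right), exactly $n$ nodes carry labels, bijectively from $[n]$, every non-leaf node is labelled (leaves may be labelled or unlabelled; unlabelled leaves are called empty), and labels increase along every path from the root. The rightmost path is $(v_1,\dots,v_d)$, $v_1$ the root, $v_{i+1}$ the right child of $v_i$, $v_d$ a leaf (the rightmost leaf). $\mathcal{T}^\circ_n$ ($\mathcal{T}^*_n$): trees whose rightmost leaf is empty (labelled). The rightmost label is the label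 of $v_{d-1}$ for $\tau\in\mathcal{T}^\circ_n$ and of $v_d$ for $\tau\in\mathcal{T}^*_n$. $\mathcal{T}^\circ_{n,k}$, $\mathcal{T}^*_{n,k}$: those with rightmost label $k$. *)

(* Defs.v *)
From mathcomp Require Import all_boot all_fingroup.
From mathcomp Require Import boolp classical_sets functions.

Set Implicit Arguments.
Unset Strict Implicit.
Unset Printing Implicit Defensive.

Local Open Scope classical_set_scope.

(* [±n]: the pair (b, i) stands for i + 1 if b = false, for -(i + 1) if
   b = true. *)
Definition pm (n : nat) : finType := (bool * 'I_n)%type.

Definition pos n (i : 'I_n) : pm n := (false, i).
Definition opp n (x : pm n) : pm n := (~~ x.1, x.2).
Definition absv n (x : pm n) : nat := x.2.+1.

Definition signed_perm n (s : {perm pm n}) : Prop :=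
  forall x : pm n, s (opp x) = opp (s x).

(* The cycles of s are the orbits porbit s x, fixed points included. *)
Definition no_self_opposite_cycle n (s : {perm pm n}) : Prop :=
  forall C, C \in porbits s -> (@opp n @: C)%SET <> C.

(* The increasing list of the positive x whose absolute value is least in their
   cycle. When no cycle satisfies C = -C, it picks one cycle from each pair
   {C, -C}. *)
Definition leaders n (s : {perm pm n}) : seq (pm n) :=
  [seq x <- map (@pos n) (enum 'I_n)
     | [forall y in porbit s x, absv x <= absv y]].

Definition cycle_notation n (s : {perm pm n}) : seq (seq (pm n)) :=
  [seq traject s x #|porbit s x| | x <- leaders s].

(* |c_1| < |c_2| > |c_3| < ..., the indices being shifted to start from 0. *)
Definition up_down n (c : seq (pm n)) : Prop :=
  let a := map (@absv n) c in
  forall j, j.+1 < size a ->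
    if odd j then nth 0 a j.+1 < nth 0 a j else nth 0 a j < nth 0 a j.+1.

Definition CUDB n : set {perm pm n} :=
  [set s | [/\ signed_perm s, no_self_opposite_cycle s
             & forall c, c \in cycle_notation s -> up_down c]].

(* The last leader is positive, hence equal to its absolute value. *)
Definition CUDBk n (k : nat) : set {perm pm n} :=
  [set s | CUDB s /\ last 0 (map (@absv n) (leaders s)) = k].

(* Leaf None is an empty leaf, Leaf (Some a) a leaf labelled a. *)
Inductive tree : Type :=
| Leaf of option nat
| Node of nat & tree & tree.

Fixpoint labels (t : tree) : seq nat :=
  match t with
  | Leaf o => seq_of_opt o
  | Node a l r => a :: labels l ++ labels r
  end.

(* The label sequences along the paths from the root to the leaves. *)
Fixpoint branches (t : tree) : seq (seq nat) :=
  match t with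
  | Leaf o => [:: seq_of_opt o]
  | Node a l r => map (cons a) (branches l ++ branches r)
  end.

Definition Tn (n : nat) : set tree :=
  [set t | perm_eq (labels t) (iota 1 n) /\ all (sorted ltn) (branches t)].

(* The labels of v_1, ..., v_d, with None for an unlabelled node. *)
Fixpoint rightmost_path (t : tree) : seq (option nat) :=
  match t with
  | Leaf o => [:: o]
  | Node a _ r => Some a :: rightmost_path r
  end.

Definition Tcirc (n : nat) : set tree :=
  [set t | Tn n t /\ last None (rightmost_path t) = None].

(* Counting from 0, v_{d-1} has index d - 2. *)
Definition Tcirck (n k : nat) : set tree :=
  [set t | Tcirc n t /\
     nth None (rightmost_path t) (size (rightmost_path t)).-2 = Some k].

(* Main.v *)
Require Import Defs.
From mathcomp Require Import all_boot all_fingroup.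
From mathcomp Require Import boolp classical_sets functions.

Set Implicit Arguments.
Unset Strict Implicit.
Unset Printing Implicit Defensive.

(* Cutting the rightmost path of a tree in T^o_n into single nodes, each with
   its left subtree, turns the tree into a list of pairs (a, t), a increasing,
   where a is smaller than the labels of t. An element of CUD^(B)_n is a list of
   cycles a :: w, a positive and increasing, where a is smaller than the absolute
   values of the rest w of the cycle, a signed word with
   |w_1| > |w_2| < |w_3| > ... The last a is the statistic k on both sides, so it
   suffices to have a bijection w |-> t from such words to increasing trees which
   preserves the label set.

   Let m be the letter of w of least absolute value. If m is negative, first
   exchange the letters of w by the permutation reversing the order of their
   absolute values: the word becomes up-down instead of down-up, and m moves
   with its sign. Write the result as u m v. Both the reverse of u and v are
   down-up; they give the left and right subtrees of a root labelled |m|.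
   Conversely, when u v is not empty, the parity of the length of u tells whether
   u m v is down-up or up-down, hence the sign of m. The one-letter words (-m)
   and (m) give the leaf labelled m and the node labelled m with two empty
   leaves. *)

(** * Down-up words and increasing trees *)

(** The flag [b] tells whether the next step is a descent, so [alt true] is down-up and [alt false]
    is up-down. *)
Fixpoint alt_path (b : bool) (x : nat) (s : seq nat) : bool :=
  if s is y :: s' then (if b then y < x else x < y) && alt_path (~~ b) y s'
  else true.

Definition alt (b : bool) (s : seq nat) : bool :=
  if s is x :: s' then alt_path b x s' else true.

Lemma alt_cons b x s :
  alt b (x :: s) =
  (if s is y :: _ then if b then y < x else x < y else true) && alt (~~ b) s.
Proof. by case: s. Qed.

Lemma alt_cat b u m v :
  alt b (u ++ m :: v) =
  alt b (rcons u m) && alt (b (+) odd (size u)) (m :: v).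
Proof.
elim: u b => [|x u IHu] b; first by rewrite addbF.
rewrite cat_cons rcons_cons !(alt_cons _ x) IHu -andbA /=.
rewrite addNb addbN.
by case: u {IHu}.
Qed.

Lemma alt_rev b s : alt b (rev s) = alt (b (+) ~~ odd (size s)) s.
Proof.
elim: s b => [|x s IHs] b //; rewrite rev_cons.
case: s IHs => [|y s] IHs //.
rewrite rev_cons -cats1 -[rcons _ y]cats1 -catA cat1s alt_cat -rev_cons IHs.
rewrite (alt_cons _ x) size_rev [size (x :: _)]/= oddS negbK andbC.
rewrite -[~~ (b (+) _)]addbN oddS negbK; congr (_ && _).
by rewrite /= andbT addbN; case: (b (+) _).
Qed.

Lemma alt_min b m v : all (ltn m) v ->
  alt b (m :: v) = nilp v || ~~ b && alt true v.
Proof.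
case: v => [|y v] // /andP[/= my _].
by case: b => /=; rewrite ?my //= ltnNge ltnW.
Qed.

(** The minimum [m] is entered by a descent and left by an ascent, so each nonempty side forces [b]
    to be the parity of the position of [m]; an empty side forces nothing. *)
Lemma alt_split b u m v : all (ltn m) u -> all (ltn m) v ->
  alt b (u ++ m :: v) =
  (nilp u || (b == odd (size u)) && alt true (rev u)) &&
  (nilp v || (b == odd (size u)) && alt true v).
Proof.
move=> mu mv; rewrite alt_cat (alt_min _ mv).
have -> : alt b (rcons u m) = alt (b (+) odd (size u)) (m :: rev u).
  by rewrite -rev_rcons alt_rev size_rcons /= negbK -addbA addbb addbF.
rewrite alt_min; last by rewrite all_rev.
by rewrite -[nilp (rev u)]/(size (rev u) == 0) size_rev; case: b (odd _) => -[].
Qed.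

Lemma alt_anti (f : nat -> nat) b s :
  {in s &, forall x y, (f x < f y) = (y < x)} ->
  alt b (map f s) = alt (~~ b) s.
Proof.
elim: s b => [|x s IHs] b // fs.
rewrite map_cons !alt_cons IHs => [|y z ys zs]; last first.
  by apply: fs; rewrite inE ?ys ?zs orbT.
case: s fs {IHs} => [|y s] //= fs.
by case: b => /=; rewrite fs // !inE eqxx ?orbT.
Qed.

(** * Reversing the order of the letters of a word *)

Definition flip_letter (w : seq nat) (x : nat) : nat :=
  let s := sort leq w in nth 0 s (size s - (index x s).+1).

Definition flip (w : seq nat) : seq nat := map (flip_letter w) w.

Lemma sorted_sort_uniq w : uniq w -> sorted ltn (sort leq w).
Proof.
move=> Uw; rewrite ltn_sorted_uniq_leq sort_uniq Uw.
exact: (sort_sorted leq_total).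
Qed.

(** The letter of rank [i] in the sorted list [s] goes to the one of rank [size s - i.+1], and this
    reflection of the ranks is an involution. *)
Lemma flip_letterK w : uniq w -> {in w, involutive (flip_letter w)}.
Proof.
move=> Uw x xw; rewrite /flip_letter; set s := sort leq w.
have lt_x : index x s < size s by rewrite index_mem mem_sort.
rewrite index_uniq ?sort_uniq //; last by rewrite ltn_subrL (leq_trans _ lt_x).
by rewrite subnSK // subKn ?nth_index ?mem_sort // ltnW.
Qed.

Lemma mem_flip_letter w x : x \in w -> flip_letter w x \in w.
Proof.
move=> xw; rewrite -(mem_sort leq); apply: mem_nth.
rewrite ltn_subrL /= (leq_ltn_trans (leq0n (index x (sort leq w)))) //.
by rewrite index_mem mem_sort.
Qed.

Lemma flip_letter_anti w : uniq w ->
  {in w &, forall x y, (flip_letter w x < flip_letter w y) = (y < x)}.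
Proof.
move=> Uw.
have anti : {in w &, forall x y, y < x -> flip_letter w x < flip_letter w y}.
  move=> x y xw yw yx; set s := sort leq w.
  have lts z : z \in w -> index z s < size s by rewrite index_mem mem_sort.
  have iyx : index y s < index x s.
    rewrite ltnNge; apply/negP => /(sorted_leq_index leq_trans leqnn).
    move=> /(_ (sort_sorted leq_total w)).
    by rewrite !mem_sort xw yw leqNgt yx => /(_ isT isT).
  apply: (sorted_ltn_nth ltn_trans 0 (sorted_sort_uniq Uw)); rewrite ?inE.
  - by rewrite ltn_subrL (leq_ltn_trans _ (lts _ xw)).
  - by rewrite ltn_subrL (leq_ltn_trans _ (lts _ xw)).
  by rewrite ltn_sub2l // (leq_ltn_trans _ (lts _ xw)).
move=> x y xw yw; apply/idP/idP => [fxy|]; last exact: anti.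
(* The converse is the same implication for the images, the map being an involution. *)
rewrite -(flip_letterK Uw xw) -(flip_letterK Uw yw).
by apply: anti => //; exact: mem_flip_letter.
Qed.

Lemma perm_flip w : uniq w -> perm_eq (flip w) w.
Proof.
move=> Uw; have Uf : uniq (flip w).
  rewrite map_inj_in_uniq // => x y xw yw eq_f.
  by rewrite -(flip_letterK Uw xw) eq_f flip_letterK.
apply: uniq_perm => //.
suff sub : {subset flip w <= w}.
  by have [] := uniq_min_size Uf sub; rewrite ?size_map.
by move=> _ /mapP[x xw ->]; exact: mem_flip_letter.
Qed.

(** [flip_letter] depends on the word only through its sorted list, which flipping preserves; so the
    second flip applies the same involution again. *)
Lemma flipK w : uniq w -> flip (flip w) = w.
Proof.
move=> Uw; rewrite {1}/flip; have -> : flip_letter (flip w) = flip_letter w.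
  rewrite /flip_letter; have /(perm_sortP leq_total leq_trans anti_leq)-> //
    := perm_flip Uw.
rewrite /flip -map_comp -[RHS]map_id; apply/eq_in_map => x xw /=.
exact: flip_letterK.
Qed.

Lemma alt_flip b w : uniq w -> alt b (flip w) = alt (~~ b) w.
Proof. by move=> Uw; apply: alt_anti => x y xw yw; exact: flip_letter_anti. Qed.

(* Letters are coded by naturals: c stands for the letter of absolute value
   c./2, negative when c is odd. *)
Definition down_up (w : seq nat) : bool := uniq (map half w) && alt true w.

(** * Splitting a word at its least letter; the tree of a word *)

Definition least (w : seq nat) : nat := head 0 (sort leq w).

Lemma leastP w : w != [::] -> least w \in w /\ all (leq (least w)) w.
Proof.
move=> w0; rewrite -(mem_sort leq) -(all_sort _ leq) /least.
have := sort_sorted leq_total w; rewrite -size_eq0 -(size_sort leq) in w0 *.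
case: (sort _ _) w0 => //= x s _ xs; rewrite inE eqxx leqnn; split=> //.
exact: order_path_min leq_trans xs.
Qed.

Lemma least_eq w m s : perm_eq w (m :: s) -> all (ltn m) s -> least w = m.
Proof.
move=> ws ms; have [|lw mw] := @leastP w.
  by apply: contraTneq ws => ->; rewrite perm_sym; apply/perm_nilP.
move: lw; rewrite (perm_mem ws) inE => /predU1P[//|/(allP ms)] /=.
by rewrite ltnNge (allP mw) // (perm_mem ws) inE eqxx.
Qed.

Lemma least_split w : uniq w -> w != [::] ->
  exists u v, [/\ w = u ++ least w :: v, all (ltn (least w)) u
                & all (ltn (least w)) v].
Proof.
move=> Uw /leastP[]; set m := least w => mw le_m.
case/splitPr: mw le_m Uw => u v.
rewrite all_cat cat_uniq /= => /and3P[le_u _ le_v] /and4P[_ mu mv _].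
exists u, v; split=> //; apply/allP => x xs /=.
  rewrite ltn_neqAle (allP le_u) // andbT; apply: contraTneq xs => <-.
  by case/norP: mu.
rewrite ltn_neqAle (allP le_v) // andbT; by apply: contraTneq xs => <-.
Qed.

Lemma uniq_half w : uniq (map half w) -> uniq w.
Proof. exact: map_uniq. Qed.

(** Odd codes are negative letters. Flipping only permutes the letters, so the least one, and with
    it the need to flip back, can still be read off the result. *)
Definition arrange (w : seq nat) : seq nat :=
  if odd (least w) then flip w else w.

(** The recursive calls are on parts of a rearranged word, hence the fuel [k]; any fuel not below
    the size of the word suffices. *)
Fixpoint wtree_rec (k : nat) (w : seq nat) : tree :=
  if k is k'.+1 then
    if w is [::] then Leaf None else
    let m := least w in
    if odd m && (size w == 1) then Leaf (Some m./2) else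
    let w' := arrange w in
    Node m./2 (wtree_rec k' (rev (take (index m w') w')))
      (wtree_rec k' (drop (index m w').+1 w'))
  else Leaf None.

Definition wtree (w : seq nat) : tree := wtree_rec (size w) w.

Lemma perm_arrange w : uniq w -> perm_eq (arrange w) w.
Proof. by rewrite /arrange; case: ifP => // _; exact: perm_flip. Qed.

Lemma wtree_rec_leaf k m : odd m -> wtree_rec k.+1 [:: m] = Leaf (Some m./2).
Proof. by move=> om /=; rewrite (@least_eq _ m [::]) ?om. Qed.

Lemma wtree_rec_node k w u m v :
    uniq w -> arrange w = u ++ m :: v -> all (ltn m) u -> all (ltn m) v ->
    ~~ (odd m && nilp (u ++ v)) ->
  wtree_rec k.+1 w = Node m./2 (wtree_rec k (rev u)) (wtree_rec k v).
Proof.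
move=> Uw eqw mu mv; have pw := perm_arrange Uw; rewrite eqw in pw.
have lw : least w = m.
  apply: (@least_eq _ _ (u ++ v)); last by rewrite all_cat mu.
  by rewrite -(permPl pw) -cat_rcons -cat_cons perm_cat2r perm_rcons.
have szw : size w = (size (u ++ v)).+1.
  by rewrite -(perm_size pw) !size_cat addnS.
move=> small /=; rewrite lw eqw szw eqSS (negbTE small).
have mNu : m \notin u by apply/negP => /(allP mu); rewrite /= ltnn.
rewrite index_cat (negbTE mNu) /= eqxx addn0 take_size_cat //.
by rewrite drop_cat ltnNge leqnSn subSnn /= drop0; case: (w) szw.
Qed.

Lemma uniq_map_in_inj (T1 T2 : eqType) (f : T1 -> T2) s :
  uniq (map f s) -> {in s &, injective f}.
Proof.
elim: s => [|z s IHs] //= /andP[zs Us] x y; rewrite !inE.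
move=> /predU1P[->|xs] /predU1P[->|ys] // eqf; last exact: IHs.
  by case/mapP: zs; exists y.
by case/mapP: zs; exists x.
Qed.

(** Halving identifies only the codes of opposite letters, which cannot both occur; hence codes
    compare like absolute values. *)
Lemma half_letter_lt w x y : uniq (map half w) -> x \in w -> y \in w ->
  x < y -> x./2 < y./2.
Proof.
move=> Uw xw yw lt_xy; rewrite ltn_neqAle half_leq 1?ltnW // andbT.
by apply: contraTneq lt_xy => /(uniq_map_in_inj Uw xw yw)->; rewrite ltnn.
Qed.

Lemma alt_arrange w : uniq w -> alt (~~ odd (least w)) (arrange w) = alt true w.
Proof. by move=> Uw; rewrite /arrange; case: ifP => // _; exact: alt_flip. Qed.

(** The arranged word alternates in a sense fixed by the sign of its least letter; by [alt_split]
    both sides, read away from that letter, are down-up. *)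
Lemma down_up_split w : down_up w -> w != [::] ->
  exists u v, [/\ arrange w = u ++ least w :: v,
    all (ltn (least w)) u, all (ltn (least w)) v,
    down_up (rev u) & down_up v].
Proof.
move=> /andP[Uh aw] w0; have Uw := uniq_half Uh.
have pw := perm_arrange Uw.
have [||u [v [eqw mu mv]]] := @least_split (arrange w).
- by rewrite (perm_uniq pw).
- by rewrite -size_eq0 (perm_size pw) size_eq0.
have lw : least (arrange w) = least w.
  by rewrite /least; have /(perm_sortP leq_total leq_trans anti_leq)-> := pw.
rewrite {}lw in eqw mu mv; exists u, v.
have := alt_arrange Uw; rewrite aw eqw alt_split // => /andP[au av].
move: Uh; rewrite -(perm_uniq (perm_map half pw)) eqw map_cat cat_uniq /=.
case/and4P=> Uu _ _ Uv; split=> //; rewrite /down_up ?map_rev ?rev_uniq ?Uu ?Uv /=.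
  by case/orP: au => [/nilP->|/andP[]].
by case/orP: av => [/nilP->|/andP[]].
Qed.

(** Inversion principle for the recursion; the node case carries the decomposition and the size
    bounds used by the inductions on the fuel. *)
Variant wtree_spec k w : tree -> Prop :=
| WtreeNil of w = [::] : wtree_spec k w (Leaf None)
| WtreeLeaf m of w = [:: m] & odd m : wtree_spec k w (Leaf (Some m./2))
| WtreeNode u m v of arrange w = u ++ m :: v & least w = m
    & all (ltn m) u & all (ltn m) v & down_up (rev u) & down_up v
    & ~~ (odd m && nilp (u ++ v))
    & size u <= k & size v <= k
    & perm_eq w (m :: rev u ++ v) :
  wtree_spec k w (Node m./2 (wtree_rec k (rev u)) (wtree_rec k v)).

Lemma wtree_recP k w : size w <= k.+1 -> down_up w ->
  wtree_spec k w (wtree_rec k.+1 w).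
Proof.
move=> szw dw; have [->|w0] := eqVneq w [::]; first exact: WtreeNil.
have Uw : uniq w by case/andP: dw => /uniq_half.
have [u [v [eqw mu mv du dv]]] := down_up_split dw w0.
have pw : perm_eq w (least w :: rev u ++ v).
  rewrite -(permPl (perm_arrange Uw)) eqw -cat_rcons -cat_cons perm_cat2r.
  by rewrite perm_rcons perm_cons perm_sym perm_rev.
have szuv : size w = (size u + size v).+1.
  by rewrite (perm_size pw) /= size_cat size_rev.
have [small|big] := boolP (odd (least w) && nilp (u ++ v)).
  case/andP: small => om; rewrite /nilp size_cat => /eqP uv0.
  rewrite uv0 in szuv; case: w szuv {dw w0 Uw eqw mu mv pw szw} om => [|m [|]] // _.
  have -> : least [:: m] = m by apply: (@least_eq _ _ [::]).
  by move=> om; rewrite wtree_rec_leaf //; exact: WtreeLeaf.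
rewrite (wtree_rec_node _ Uw eqw) //; apply: WtreeNode => //.
  by rewrite szuv ltnS in szw; exact: leq_trans (leq_addr _ _) szw.
by rewrite szuv ltnS in szw; exact: leq_trans (leq_addl _ _) szw.
Qed.

(** Comparing a node with all its descendants suits induction better than [branches]; [mem_Tn]
    relates the two. *)
Fixpoint increasing (t : tree) : bool :=
  match t with
  | Leaf _ => true
  | Node a l r =>
    [&& all (ltn a) (labels l ++ labels r), increasing l & increasing r]
  end.

Lemma labels_wtree_rec k w : size w <= k -> down_up w ->
  perm_eq (labels (wtree_rec k w)) (map half w).
Proof.
elim: k w => [|k IHk] w; first by rewrite leqn0 size_eq0 => /eqP->.
move=> szw dw; case: wtree_recP => // [->|m -> om|] //=.
move=> u m v eqw lw mu mv du dv _ szu szv pw.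
rewrite (permPr (perm_map half pw)) /= perm_cons map_cat.
by apply: perm_cat; apply: IHk; rewrite ?size_rev.
Qed.

Lemma increasing_wtree_rec k w : size w <= k -> down_up w ->
  increasing (wtree_rec k w).
Proof.
elim: k w => [|k IHk] w //.
move=> szw dw; case: wtree_recP => // u m v eqw lw mu mv du dv _ szu szv pw /=.
rewrite !IHk ?size_rev // !andbT all_cat.
rewrite !(perm_all _ (labels_wtree_rec _ _)) ?size_rev // -all_cat -map_cat.
case/andP: dw => Uw _; apply/allP => _ /mapP[x xuv ->] /=.
apply: (half_letter_lt Uw); rewrite ?(perm_mem pw) ?mem_head //.
  by rewrite inE xuv orbT.
by move: xuv; rewrite mem_cat mem_rev => /orP[/(allP mu)|/(allP mv)].
Qed.

Lemma arrange_odd_inj w1 w2 : uniq w1 -> uniq w2 ->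
  odd (least w1) = odd (least w2) -> arrange w1 = arrange w2 -> w1 = w2.
Proof.
move=> U1 U2; rewrite /arrange => <-; case: ifP => // _ eqf.
by rewrite -(flipK U1) eqf flipK.
Qed.

(* If the least letters of w1 and w2 had opposite signs, their arrangements
   would be alternating in opposite senses; but by [alt_split] the parity of the
   position of the least letter determines the sense. *)
Lemma wtree_rec_inj k w1 w2 :
    size w1 <= k -> size w2 <= k -> down_up w1 -> down_up w2 ->
  wtree_rec k w1 = wtree_rec k w2 -> w1 = w2.
Proof.
elim: k w1 w2 => [|k IHk] w1 w2.
  by rewrite !leqn0 !size_eq0 => /eqP-> /eqP->.
move=> sz1 sz2 d1 d2.
case: (wtree_recP sz1 d1) =>
  [-> | m1 -> o1 | u1 m1 v1 e1 l1 mu1 mv1 du1 dv1 n1 szu1 szv1 _].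
- by case: (wtree_recP sz2 d2).
- case: (wtree_recP sz2 d2) => // m2 -> o2 [eqm].
  by rewrite -(odd_double_half m1) -(odd_double_half m2) o1 o2 eqm.
case: (wtree_recP sz2 d2) =>
  // u2 m2 v2 e2 l2 mu2 mv2 du2 dv2 n2 szu2 szv2 _ [em eu ev].
have {eu} eu : u1 = u2 by apply: (can_inj revK); apply: IHk eu; rewrite ?size_rev.
have {ev} ev : v1 = v2 by apply: IHk ev.
have /uniq_half U1 : uniq (map half w1) by case/andP: d1.
have /uniq_half U2 : uniq (map half w2) by case/andP: d2.
subst u2 v2; have eo : odd m1 = odd m2.
  move: (alt_arrange U1) (alt_arrange U2); rewrite l1 l2 e1 e2.
  have [_ ->] := andP d1; have [_ ->] := andP d2.
  rewrite !alt_split // => /andP[a1 b1] /andP[a2 b2].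
  (* With both sides empty the words have one letter, and since neither gave a leaf both letters are
     positive. *)
  have : ~~ nilp u1 || ~~ nilp v1 || (odd m1 == odd m2).
    move: n1 n2; rewrite -!(rwP negP) /nilp !size_cat addn_eq0.
    by do 2!case: (size _ == 0); case: (odd m1) (odd m2) => -[].
  case: (nilp u1) a1 a2 => /=; last first.
    by move=> /andP[/eqP<- _] /andP[/eqP/(can_inj negbK)].
  case: (nilp v1) b1 b2 => /=; last first.
    by move=> /andP[/eqP<- _] /andP[/eqP/(can_inj negbK)].
  by move=> _ _ _ _ /eqP.
have {}em : m1 = m2 by rewrite -(odd_double_half m1) -(odd_double_half m2) eo em.
by apply: arrange_odd_inj; rewrite ?l1 ?l2 // e1 e2 em.
Qed.

Lemma size_labels_wtree w : down_up w -> size (labels (wtree w)) = size w.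
Proof. by move/(labels_wtree_rec (leqnn _))/perm_size; rewrite size_map. Qed.

Lemma wtree_inj w1 w2 : down_up w1 -> down_up w2 ->
  wtree w1 = wtree w2 -> w1 = w2.
Proof.
(* Equal trees carry equally many labels, so both words were processed with the same fuel. *)
move=> d1 d2 e; have sz : size w1 = size w2.
  by rewrite -(size_labels_wtree d1) e size_labels_wtree.
apply: (@wtree_rec_inj (size w1)) => //; first by rewrite sz.
by move: e; rewrite /wtree -sz.
Qed.

Lemma bit_double_lt (b : bool) a x : a < x./2 -> b + a.*2 < x.
Proof. by rewrite geq_half_double; apply: leq_trans; case: b. Qed.

(** All sufficient fuels are allowed because the words of the subtrees are processed with what is
    left of the fuel of the whole word. *)
Lemma wtree_surj t : increasing t -> uniq (labels t) ->
  exists w, down_up w /\ forall k, size w <= k -> wtree_rec k w = t.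
Proof.
elim: t => [[a|]|a l IHl r IHr] /=.
(* A labelled leaf comes from a single negative letter. *)
- move=> _ _; exists [:: a.*2.+1]; split=> // -[//|k] _.
  by rewrite wtree_rec_leaf /= ?odd_double // uphalf_double.
- by move=> _ _; exists [::]; split=> // -[].
rewrite all_cat -!andbA => /and4P[al ar il ir] U.
have := U; rewrite cat_uniq => /and4P[_ Ul _ Ur].
have [wl [dl tl]] := IHl il Ul; have [wr [dr tr]] := IHr ir Ur.
have pl : perm_eq (labels l) (map half wl).
  by rewrite -(tl _ (leqnn _)); exact: labels_wtree_rec.
have pr : perm_eq (labels r) (map half wr).
  by rewrite -(tr _ (leqnn _)); exact: labels_wtree_rec.
(* The sign [b] of the root letter stays open until the sense of alternation is known. *)
pose m (b : bool) := b + a.*2; pose w0 b := rev wl ++ m b :: wr.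
have ml b : all (ltn (m b)) (rev wl).
  rewrite all_rev; apply/allP => x xw /=; apply: bit_double_lt.
  by apply: (allP al); rewrite (perm_mem pl) map_f.
have mr b : all (ltn (m b)) wr.
  apply/allP => x xw /=; apply: bit_double_lt.
  by apply: (allP ar); rewrite (perm_mem pr) map_f.
have Uw b : uniq (map half (w0 b)).
  have /perm_uniq-> // : perm_eq (map half (w0 b)) (a :: labels l ++ labels r).
  rewrite map_cat map_rev /= half_bit_double -cat_rcons -cat_cons.
  apply: perm_cat; last by rewrite perm_sym.
  by rewrite perm_rcons perm_cons perm_rev perm_sym.
(* Both sides being down-up, [alt_split] makes the concatenation down-up or up-down, and this sets
   the sign. If both sides are empty, [c] is false, as a node with two empty leaves requires. *)
pose c := ~~ alt true (w0 false).
have altc : alt (~~ c) (w0 c).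
  rewrite /c; have [//|] := boolP (alt true (w0 false)).
  have /andP[_ al'] := dl; have /andP[_ ar'] := dr.
  by rewrite !alt_split // revK al' ar' !andbT; case: (odd _); rewrite ?orbT.
have bigc : ~~ (odd (m c) && nilp (rev wl ++ wr)).
  rewrite /m oddD oddb odd_double addbF; apply/negP => /andP[+ /nilP].
  rewrite /c /w0; case: (rev wl) => //= /[swap] ->.
  by [].
(* For a negative root letter [arrange] will flip the word, so it is flipped beforehand. *)
exists (if c then flip (w0 c) else w0 c).
set w := if c then _ else _.
have Uwc := uniq_half (Uw c).
have pw : perm_eq w (w0 c) by rewrite /w; case: (c) Uwc => // ?; exact: perm_flip.
have lw : least w = m c.
  apply: (@least_eq _ _ (rev wl ++ wr)); last by rewrite all_cat ml mr.
  by rewrite (permPl pw) /w0 -cat_rcons -cat_cons perm_cat2r perm_rcons.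
split.
  rewrite /down_up (perm_uniq (perm_map half pw)) Uw /w.
  by move: altc Uwc; case: (c) => // ac Uc; rewrite alt_flip.
have eqw : arrange w = w0 c.
  rewrite /arrange lw /m oddD oddb odd_double addbF /w.
  by move: Uwc; case: (c) => // Uc; exact: flipK.
case=> [|k]; rewrite (perm_size pw) size_cat size_rev addnS //.
rewrite ltnS => szk; rewrite (wtree_rec_node _ _ eqw) ?(perm_uniq pw) // revK.
rewrite half_bit_double tl ?tr //; first exact: leq_trans (leq_addl _ _) szk.
exact: leq_trans (leq_addr _ _) szk.
Qed.

(** * Lists of cycles and trees with an empty rightmost leaf *)

Definition canonical (c : seq nat) : bool :=
  if c is a :: w then [&& ~~ odd a, all (ltn a) w & alt true w] else false.

(** The absolute values have to be distinct but not to fill [[n]], so that the tail of such a list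
    is again one. *)
Definition cycle_list (cs : seq (seq nat)) : bool :=
  [&& all canonical cs, sorted ltn (map (head 0) cs)
    & uniq (map half (flatten cs))].

Definition forest : seq (seq nat) -> tree :=
  foldr (fun c => Node (head 0 c)./2 (wtree (behead c))) (Leaf None).

Lemma cycle_list_cons c cs : cycle_list (c :: cs) -> cycle_list cs.
Proof.
rewrite /cycle_list /= map_cat cat_uniq => /and3P[/andP[_ ->] srt].
by case/and3P=> _ _ ->; rewrite (path_sorted srt).
Qed.

(** The heads increase and each is least in its cycle, so the first head lies below all other
    letters. *)
Lemma cycle_list_head a w cs : cycle_list ((a :: w) :: cs) ->
  [/\ ~~ odd a, down_up w & {in w ++ flatten cs, forall x, a < x}].
Proof.
rewrite /cycle_list /= map_cat /down_up => /and3P[].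
case/andP=> /and3P[oa aw ->] ccs srt /andP[_]; rewrite cat_uniq => /andP[-> _].
split=> // x; rewrite mem_cat => /orP[/(allP aw)//|/flattenP[c cin xc]].
have /allP/(_ (head 0 c)) := order_path_min ltn_trans srt.
rewrite map_f //= => /(_ isT) ac.
case: c cin xc ac => // b v /(allP ccs)/and3P[_ bv _] /=.
by rewrite inE => /predU1P[->//|/(allP bv) /=]; move/(ltn_trans _); apply.
Qed.

Lemma labels_forest cs : cycle_list cs ->
  perm_eq (labels (forest cs)) (map half (flatten cs)).
Proof.
elim: cs => [|[|a w] cs IHcs] // vcs.
have [_ dw _] := cycle_list_head vcs.
rewrite /= perm_cons map_cat perm_cat ?IHcs ?(cycle_list_cons vcs) //.
exact: labels_wtree_rec.
Qed.

Lemma increasing_forest cs : cycle_list cs -> increasing (forest cs).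
Proof.
elim: cs => [|[|a w] cs IHcs] // vcs.
have [_ dw acs] := cycle_list_head vcs; have vcs' := cycle_list_cons vcs.
rewrite /= IHcs // increasing_wtree_rec // !andbT all_cat.
rewrite (perm_all _ (labels_wtree_rec _ _)) // (perm_all _ (labels_forest _)) //.
rewrite -all_cat -map_cat; apply/allP => _ /mapP[x xin ->] /=.
have /and3P[_ _ U] := vcs.
apply: (half_letter_lt U); rewrite /= ?mem_head //; last exact: acs.
by rewrite inE xin orbT.
Qed.

Lemma rightmost_path_forest cs :
  rightmost_path (forest cs) = rcons [seq Some (head 0 c)./2 | c <- cs] None.
Proof. by elim: cs => //= c cs ->. Qed.

Lemma forest_inj cs1 cs2 : cycle_list cs1 -> cycle_list cs2 ->
  forest cs1 = forest cs2 -> cs1 = cs2.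
Proof.
elim: cs1 cs2 => [|[|a1 w1] cs1 IHcs] [|[|a2 w2] cs2] // v1 v2 [ea ew ecs].
have [o1 d1 _] := cycle_list_head v1; have [o2 d2 _] := cycle_list_head v2.
rewrite (IHcs cs2 (cycle_list_cons v1) (cycle_list_cons v2) ecs).
by rewrite (wtree_inj d1 d2 ew) -(even_halfK o1) ea even_halfK.
Qed.

(** The induction unrolls the rightmost path, whose empty end is the empty list of cycles; each left
    subtree is treated by [wtree_surj]. *)
Lemma forest_surj t : increasing t -> uniq (labels t) ->
  last None (rightmost_path t) = None ->
  exists2 cs, cycle_list cs & forest cs = t.
Proof.
elim: t => [[a|]|a l _ r IHr] //=; first by exists [::].
rewrite all_cat -!andbA => /and4P[al ar il ir] U lastN.
have := U; rewrite cat_uniq => /and4P[_ Ul _ Ur].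
have [|cs vcs tr] := IHr ir Ur; first by case: (r) lastN.
have [w [dw tl]] := wtree_surj il Ul.
have pl : perm_eq (labels l) (map half w).
  by rewrite -(tl _ (leqnn _)); exact: labels_wtree_rec.
have pr : perm_eq (labels r) (map half (flatten cs)).
  by rewrite -tr; exact: labels_forest.
exists ((a.*2 :: w) :: cs); last by rewrite /= doubleK tr /wtree tl.
have aw : all (ltn a.*2) w.
  apply/allP => x xw; apply: (@bit_double_lt false).
  by apply: (allP al); rewrite (perm_mem pl) map_f.
have /and3P[ccs srt _] := vcs; have /andP[_ aw'] := dw.
apply/and3P; split; rewrite /= ?odd_double ?aw ?aw' ?ccs //.
  (* Half of the next head, if any, is a label of [r], hence exceeds [a]. *)
  case: (cs) srt ccs pr => [|[|b v] cs'] //= -> _ pr; rewrite andbT.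
  by apply: (@bit_double_lt false); apply: (allP ar); rewrite (perm_mem pr) mem_head.
suff eqU : uniq (a :: labels l ++ labels r) =
  uniq (a :: map half w ++ map half (flatten cs)).
  by rewrite doubleK map_cat; have : uniq (a :: _) := U; rewrite eqU.
by apply: perm_uniq; rewrite perm_cons perm_cat.
Qed.

(** * Cycles of signed permutations *)

Lemma alt_nthP b s :
  reflect (forall j, j.+1 < size s ->
    if b (+) odd j then nth 0 s j.+1 < nth 0 s j else nth 0 s j < nth 0 s j.+1)
  (alt b s).
Proof.
elim: s b => [|x s IHs] b; first by constructor.
rewrite alt_cons; apply: (iffP andP) => [[h /IHs hs] [|j] /= ltj|h].
- by rewrite addbF; case: s h {IHs hs} ltj => [|y s].
- by rewrite addbN -addNb; exact: hs.
split; first by case: s h {IHs} => [|y s] // /(_ 0 isT); rewrite addbF.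
by apply/IHs => j ltj; have := h j.+1 ltj; rewrite /= addbN -addNb.
Qed.

Lemma alt_half b s : uniq (map half s) -> alt b (map half s) = alt b s.
Proof.
move=> Us.
have lt_half : {in s &, forall x y, (x./2 < y./2) = (x < y)}.
  move=> x y xs ys; apply/idP/idP; last exact: half_letter_lt Us xs ys.
  by apply: contraTT; rewrite -!leqNgt => /half_leq.
elim: s b lt_half {Us} => [|x s IHs] b // lt_half.
rewrite map_cons !alt_cons IHs => [|y z ys zs]; last first.
  by apply: lt_half; rewrite inE ?ys ?zs orbT.
case: s lt_half {IHs} => [|y s] //= lt_half.
by case: b => /=; rewrite lt_half // !inE eqxx ?orbT.
Qed.

(** * Increasing trees in terms of branches *)

Lemma branches_neq0 t : branches t != [::].
Proof. by elim: t => //= a l; case: (branches l). Qed.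

Lemma mem_Tn n t :
  Tn n t <-> perm_eq (labels t) (iota 1 n) /\ increasing t.
Proof.
(* Prefixing the branches by a lower bound [a] makes the claim inductive: a subtree is seen together
   with the label of its parent. *)
have path_branches a u :
    all (path ltn a) (branches u) = all (ltn a) (labels u) && increasing u.
  elim: u a => [[b|]|b l IHl r IHr] a //=; rewrite all_map.
  have [ab|ba] := ltnP a b; last first.
    (* Some branch exists, and it violates the bound. *)
    case: (branches l) (branches_neq0 l) => //= c cs _.
    by rewrite ltnNge ba.
  rewrite (@eq_all _ _ (path ltn b)) => [|c /=]; last by rewrite ab.
  rewrite all_cat IHl IHr !all_cat.
  have sub u : all (ltn b) (labels u) -> all (ltn a) (labels u).
    by apply: sub_all => x /=; exact: ltn_trans.
  have [/sub->|_] := boolP (all (ltn b) (labels l)); last by rewrite !andbF.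
  have [/sub->|_] := boolP (all (ltn b) (labels r)); last by rewrite !andbF.
  by [].
suff sorted_branches : all (sorted ltn) (branches t) = increasing t.
  by rewrite /Tn /= sorted_branches; split=> [[]|[]].
case: t => [[a|]|a l r] //=; rewrite all_map -[LHS]/(all (path ltn a) _).
by rewrite !all_cat !path_branches; rewrite andbACA andbA.
Qed.

(** * Coded letters and the cycles of a signed permutation *)

Section Code.
Variable n : nat.
Implicit Types x y : pm n.

Definition code x : nat := x.1 + (absv x).*2.

Lemma half_code x : (code x)./2 = absv x.
Proof. exact: half_bit_double. Qed.

Lemma odd_code x : odd (code x) = x.1.
Proof. by rewrite oddD odd_double addbF oddb. Qed.

Lemma code_inj : injective code.
Proof.
move=> x y exy; have := congr1 half exy; have := congr1 odd exy.
rewrite !odd_code !half_code; case: x y {exy} => [b i] [c j] /= -> [eij].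
by congr pair; apply: val_inj.
Qed.

Lemma oppK : involutive (@opp n).
Proof. by case=> b i; rewrite /opp negbK. Qed.

Lemma absv_eq x y : absv x = absv y -> y = x \/ y = opp x.
Proof.
case: x y => [b i] [c j] [/val_inj->]; rewrite /opp /=.
by have [->|] := eqVneq c b; [left | case: b c => -[]; right].
Qed.

Lemma pos_absv_inj x y : ~~ x.1 -> ~~ y.1 -> absv x = absv y -> x = y.
Proof.
move=> x1 y1 exy; case: (absv_eq exy) => // ey.
by rewrite ey /= x1 in y1.
Qed.

Lemma code_surj c : 0 < c./2 <= n -> exists x, code x = c.
Proof.
case/andP=> c0 cn; have lt_cn : c./2.-1 < n by rewrite prednK.
exists (odd c, Ordinal lt_cn).
by rewrite /code /absv /= prednK // odd_double_half.
Qed.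

Lemma leq_code x y : ~~ x.1 -> absv x <= absv y -> code x <= code y.
Proof.
rewrite /code => /negbTE-> le_xy; rewrite add0n.
by rewrite (leq_trans _ (leq_addl _ _)) // leq_double.
Qed.

Lemma mem_leaders (s : {perm pm n}) x :
  (x \in leaders s) = ~~ x.1 && [forall y in porbit s x, absv x <= absv y].
Proof.
rewrite mem_filter andbC; congr (_ && _).
apply/mapP/idP => [[i _ ->]//|x1]; exists x.2; first by rewrite mem_enum.
by case: x x1 => -[].
Qed.

Lemma sorted_code_leaders (s : {perm pm n}) : sorted ltn (map code (leaders s)).
Proof.
rewrite sorted_map sorted_filter //; first by move=> ? ? ?; exact: ltn_trans.
rewrite -sorted_map -map_comp.
have -> : map (code \o @pos n) (enum 'I_n) = map (fun i => i.+1.*2) (iota 0 n).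
  by rewrite -val_enum_ord -map_comp; apply: eq_map.
rewrite sorted_map (sub_sorted _ (iota_ltn_sorted 0 n)) // => i j /=.
by rewrite ltn_double.
Qed.

Section Perm.
Variable s : {perm pm n}.

Lemma fcycle_traject_porbit x : fcycle s (traject s x #|porbit s x|).
Proof.
have /prednK e : 0 < #|porbit s x| by rewrite lt0n card_porbit_neq0.
rewrite -e /= -[X in rcons _ X](iter_porbit s x) -{2}e iterSr -trajectSr.
exact: fpath_traject.
Qed.

Lemma cycle_notationP c : reflect
  (exists2 x, x \in leaders s & c = traject s x #|porbit s x|)
  (c \in cycle_notation s).
Proof. exact: mapP. Qed.

Lemma cycle_notation_next c y : c \in cycle_notation s -> y \in c ->
  s y = next c y.
Proof.
case/cycle_notationP=> x _ -> yc.
by rewrite (nextE (fcycle_traject_porbit x)).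
Qed.

Hypothesis signed : signed_perm s.

Lemma expg_opp i x : (s ^+ i)%g (opp x) = opp ((s ^+ i)%g x).
Proof. by elim: i => [|i IHi]; rewrite ?expg0 ?perm1 // !expgSr !permM IHi signed. Qed.

Lemma porbit_opp x y : y \in porbit s x -> opp y \in porbit s (opp x).
Proof. by case/porbitP=> i ->; rewrite -expg_opp mem_porbit. Qed.

(** A letter of least absolute value in the cycle of [x] is a leader if positive; otherwise its
    opposite leads the opposite cycle, which contains [opp x]. *)
Lemma cycle_notation_cover x : exists2 c, c \in cycle_notation s &
  (x \in c) || (opp x \in c).
Proof.
have [z zx zmin] : exists2 z, z \in porbit s x &
    [forall y in porbit s x, absv z <= absv y].
  case: (arg_minnP (@absv n) (porbit_id s x)) => z zx zmin; exists z => //.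
  by apply/forall_inP.
have ez : porbit s z = porbit s x by apply/eqP; rewrite eq_porbit_mem.
have [z1|z1] := boolP z.1; last first.
  exists (traject s z #|porbit s z|).
    by apply/cycle_notationP; exists z => //; rewrite mem_leaders z1 ez.
  by rewrite -!porbit_traject ez porbit_id.
have eoz : porbit s (opp z) = porbit s (opp x).
  by apply/eqP; rewrite eq_porbit_mem porbit_opp.
exists (traject s (opp z) #|porbit s (opp z)|).
  apply/cycle_notationP; exists (opp z) => //; rewrite mem_leaders /= z1 /=.
  apply/forall_inP => y; rewrite eoz => /porbit_opp; rewrite oppK => yx.
  exact: (forall_inP zmin _ yx).
by rewrite -!porbit_traject eoz porbit_id orbT.
Qed.

Hypothesis nopp : no_self_opposite_cycle s.

(** Otherwise [x] and [opp x] would have the same orbit, which negation would then preserve. *)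
Lemma opp_notin_porbit x : opp x \notin porbit s x.
Proof.
apply/negP => oxx; have /nopp : porbit s x \in porbits s by exact: imset_f.
have eo : porbit s (opp x) = porbit s x by apply/eqP; rewrite eq_porbit_mem.
case; apply/setP => y; apply/imsetP/idP => [[z zx ->]|yx].
  by rewrite -eo porbit_opp.
by exists (opp y); rewrite ?oppK // -eo porbit_opp.
Qed.

(** As [y] and [y'] are equal or opposite, so are their cycles; the two leaders then have the same
    least absolute value and, being positive, agree. Opposite letters never share a cycle, so [y]
    and [y'] agree too. *)
Lemma leaders_absv_inj x x' y y' : x \in leaders s -> x' \in leaders s ->
    y \in porbit s x -> y' \in porbit s x' -> absv y = absv y' ->
  x = x' /\ y = y'.
Proof.
move=> xl x'l yx yx' eqa; suff exx : x = x'.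
  split=> //; case: (absv_eq eqa) => // ey'.
  have := opp_notin_porbit x; rewrite -eq_porbit_mem.
  have /eqP<- : porbit s y' == porbit s x by rewrite eq_porbit_mem exx.
  have /eqP<- : porbit s y' == porbit s (opp x).
    by rewrite eq_porbit_mem ey' porbit_opp.
  by rewrite eqxx.
move: xl x'l; rewrite !mem_leaders => /andP[x1 /forall_inP xmin].
move=> /andP[x1' /forall_inP xmin']; apply: pos_absv_inj => //; apply/eqP.
case: (absv_eq eqa) yx' => -> yx'; rewrite eqn_leq.
  have exx : porbit s x = porbit s x'.
    by apply/eqP; rewrite -(eqP (_ : porbit s y == porbit s x)) eq_porbit_mem.
  have xx' : x \in porbit s x' by rewrite -exx porbit_id.
  by rewrite (xmin x') ?(xmin' x) // porbit_sym.
have oxx' : opp x \in porbit s x'.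
  rewrite -eq_porbit_mem -(eqP (_ : porbit s (opp y) == porbit s x')) ?eq_porbit_mem //.
  by rewrite -eq_porbit_mem eq_sym eq_porbit_mem porbit_opp.
by rewrite (xmin (opp x')) ?(xmin' (opp x)) // -[x]oppK porbit_opp // porbit_sym.
Qed.

End Perm.
End Code.

(** * Permutations with prescribed cycles *)

Lemma map_uniq_flatten (T T' : eqType) (f : T -> T') (c : seq T) cs :
  uniq (map f (flatten cs)) -> c \in cs -> uniq (map f c).
Proof.
elim: cs => //= d cs IHcs; rewrite map_cat cat_uniq inE => /and3P[Ud _ Ucs].
by case/predU1P=> [->|/IHcs]; last apply.
Qed.

Lemma map_surj (S T : eqType) (f : S -> T) (w : seq T) :
  (forall y, y \in w -> exists x : S, f x = y) -> exists v, map f v = w.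
Proof.
elim: w => [|y w IHw] fw; first by exists [::].
have [v <-] : exists v, map f v = w.
  by apply: IHw => z zw; apply: fw; rewrite inE zw orbT.
by have [x <-] := fw y (mem_head _ _); exists (x :: v).
Qed.

Lemma perm_of_cycles (T : finType) (ds : seq (seq T)) : uniq (flatten ds) ->
  exists s : {perm T}, forall d, d \in ds -> {in d, s =1 next d}.
Proof.
(* The induction also needs all points outside the cycles to be fixed, so that disjoint cycles do
   not disturb each other. *)
suff H : uniq (flatten ds) -> exists2 s : {perm T},
    (forall d, d \in ds -> {in d, s =1 next d})
    & forall x, x \notin flatten ds -> s x = x.
  by move=> /H[s]; exists s.
elim: ds => [_|d ds IHds] /=; first by exists 1%g => // x _; rewrite perm1.
rewrite cat_uniq => /and3P[Ud /hasPn dds /IHds[s sds sfix]].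
have next_id (x : T) : x \notin d -> next d x = x.
  by move=> xd; rewrite next_nth (negbTE xd).
(* The second factor is the cyclic permutation along [d]. *)
exists (s * perm (can_inj (prev_next Ud)))%g => [e|x].
  rewrite inE => /predU1P[->|eds] x xe; rewrite permM permE.
    by rewrite sfix //; apply: contraL xe; exact: dds.
  rewrite (sds e eds x xe) next_id //; apply: dds; apply/flattenP; exists e => //.
  by rewrite mem_next.
by rewrite mem_cat negb_or permM permE => /andP[xd xds]; rewrite sfix // next_id.
Qed.

Lemma porbit_cycle (T : finType) (s : {perm T}) (d : seq T) (x : T) :
  uniq d -> {in d, s =1 next d} -> x \in d -> porbit s x =i d.
Proof.
move=> Ud sd xd y; have fd : fcycle s d.
  by apply: cycle_from_next => // z zd /=; rewrite sd.
rewrite -(fconnect_cycle fd xd); apply/porbitP/idP => [[i ->]|/iter_findex <-].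
  by rewrite permX fconnect_iter.
by exists (findex s x y); rewrite permX.
Qed.

Lemma traject_cycle (T : finType) (s : {perm T}) (d : seq T) (x : T) :
    uniq (x :: d) -> {in x :: d, s =1 next (x :: d)} ->
  traject s x #|porbit s x| = x :: d.
Proof.
move=> Ud sd; have fd : fcycle s (x :: d).
  by apply: cycle_from_next => // z zd /=; rewrite sd.
rewrite (eq_card (porbit_cycle Ud sd (mem_head _ _))) (card_uniqP Ud).
by rewrite [RHS](fcycle_consE fd).
Qed.

(** * Signed permutations as coded lists of cycles *)

Section Codes.
Variable n : nat.
Implicit Types (s : {perm pm n}) (x : pm n).

Definition codes s : seq (seq nat) := map (map (@code n)) (cycle_notation s).

Lemma traject_porbitS s x :
  traject s x #|porbit s x| = x :: traject s (s x) #|porbit s x|.-1.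
Proof. by rewrite -trajectS prednK // lt0n card_porbit_neq0. Qed.

Lemma heads_codes s : map (head 0) (codes s) = map (@code n) (leaders s).
Proof.
rewrite /codes /cycle_notation -!map_comp; apply: eq_map => x /=.
by rewrite traject_porbitS.
Qed.

Lemma half_flatten_codes s :
  map half (flatten (codes s)) = map (@absv n) (flatten (cycle_notation s)).
Proof.
by rewrite -map_flatten -map_comp; apply: eq_map => x /=; exact: half_code.
Qed.

Lemma uniq_absv_cycle_notation s : signed_perm s -> no_self_opposite_cycle s ->
  uniq (map (@absv n) (flatten (cycle_notation s))).
Proof.
move=> signed nopp; rewrite map_flatten -map_comp.
apply: (@allpairs_uniq_dep _ _ _ (fun _ => @absv n)).
- exact: map_uniq (sorted_uniq ltn_trans ltnn (sorted_code_leaders s)).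
- by move=> x _; exact: uniq_traject_porbit.
move=> _ _ /allpairsPdep[x [y [xl yx ->]]] /allpairsPdep[x' [y' [xl' yx' ->]]] /=.
rewrite -!porbit_traject in yx yx' => eqa.
by have [-> ->] := leaders_absv_inj signed nopp xl xl' yx yx' eqa.
Qed.

Lemma perm_codes s : signed_perm s -> no_self_opposite_cycle s ->
  perm_eq (map half (flatten (codes s))) (iota 1 n).
Proof.
move=> signed nopp; rewrite half_flatten_codes; apply: uniq_perm.
- exact: uniq_absv_cycle_notation.
- exact: iota_uniq.
move=> a; rewrite mem_iota add1n ltnS; apply/mapP/idP => [[[b i] _ ->]|/andP[a0 an]].
  by rewrite /absv /= ltn_ord.
have lt_an : a.-1 < n by rewrite prednK.
have [c cs] := cycle_notation_cover signed (pos (Ordinal lt_an)).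
case/orP=> xc; [exists (pos (Ordinal lt_an)) | exists (opp (pos (Ordinal lt_an)))];
  by [apply/flattenP; exists c | rewrite /absv /= prednK].
Qed.

Lemma up_down_code (c : seq (pm n)) : uniq (map (@absv n) c) ->
  up_down c <-> alt false (map (@code n) c).
Proof.
rewrite /up_down; have <- : map half (map (@code n) c) = map (@absv n) c.
  by rewrite -map_comp; apply: eq_map => x /=; rewrite half_code.
by move=> Uc; rewrite -(alt_half _ Uc); exact: rwP (@alt_nthP false _).
Qed.

Lemma cycle_list_codes s : CUDB s -> cycle_list (codes s).
Proof.
case=> signed nopp ud; have Us := uniq_absv_cycle_notation signed nopp.
apply/and3P; split; last by rewrite half_flatten_codes.
  rewrite all_map; apply/allP => c cs /=.
  have := ud c cs; rewrite up_down_code ?(map_uniq_flatten Us cs) //.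
  case/cycle_notationP: cs => x; rewrite mem_leaders => /andP[x1 /forall_inP xmin] ->.
  have := uniq_traject_porbit s x; have := porbit_traject s x.
  rewrite traject_porbitS => memx /andP[xNt _] /= altx; rewrite odd_code x1 /=.
  have minx : all (ltn (code x)) (map (@code n) (traject s (s x) #|porbit s x|.-1)).
    rewrite all_map; apply/allP => y yt /=.
    have yx : y \in porbit s x by rewrite memx inE yt orbT.
    rewrite ltn_neqAle (leq_code x1 (xmin y yx)) andbT.
    by rewrite (inj_eq (@code_inj n)); apply: contraNneq xNt => exy; rewrite {1}exy.
  (* The leader is a strict minimum, so the first step goes up and the tail of the up-down cycle is
     down-up. *)
  rewrite minx; have := alt_min false minx; rewrite /= altx => /esym.
  by case/orP=> // /nilP->.
by rewrite heads_codes sorted_code_leaders.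
Qed.

(** The notation determines the permutation on one cycle of each opposite pair, and signedness
    determines it on the other. *)
Lemma codes_inj s t : CUDB s -> CUDB t -> codes s = codes t -> s = t.
Proof.
case=> signed_s _ _ [signed_t _ _] /(inj_map (inj_map (@code_inj n))) eqst.
apply/permP => x; have [c cs] := cycle_notation_cover signed_s x.
have ct : c \in cycle_notation t by rewrite -eqst.
case/orP=> xc; first by rewrite (cycle_notation_next cs) // (cycle_notation_next ct).
apply: (can_inj (@oppK n)); rewrite -signed_s -signed_t.
by rewrite (cycle_notation_next cs) // (cycle_notation_next ct).
Qed.

Lemma codes_surj cs : 0 < n -> cycle_list cs ->
  perm_eq (map half (flatten cs)) (iota 1 n) ->
  exists2 s, CUDB s & codes s = cs.
Proof.
move=> n0 vcs pcs; have /and3P[ccs srt Ucs] := vcs.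
have [ds eqcs] : exists ds, map (map (@code n)) ds = cs.
  apply: map_surj => w wcs; apply: map_surj => c cw; apply: code_surj.
  have : c./2 \in map half (flatten cs) by apply: map_f; apply/flattenP; exists w.
  by rewrite (perm_mem pcs) mem_iota add1n ltnS.
have eqds : map half (flatten cs) = map (@absv n) (flatten ds).
  by rewrite -eqcs -map_flatten -map_comp; apply: eq_map => x /=; exact: half_code.
have Uds : uniq (map (@absv n) (flatten ds)) by rewrite -eqds.
have absv_inj := uniq_map_in_inj Uds.
(* Signedness forces the opposites of the given cycles to be cycles as well; together they cover
   each letter exactly once. *)
pose op := map (map (@opp n)) ds.
have oppNds x : x \in flatten ds -> opp x \notin flatten ds.
  by move=> xd; apply/negP => /(absv_inj _ _ xd)/(_ erefl); case: (x) => -[].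
have mem_op x : (x \in flatten op) = (opp x \in flatten ds).
  by rewrite /op -map_flatten -{1}[x]oppK (mem_map (inv_inj (@oppK n))).
have Ufull : uniq (flatten (ds ++ op)).
  rewrite flatten_cat cat_uniq (map_uniq Uds) /op -map_flatten.
  rewrite (map_inj_uniq (inv_inj (@oppK n))) (map_uniq Uds) andbT.
  by apply/hasPn => _ /mapP[x xd ->]; exact: oppNds.
have cover x : (x \in flatten ds) || (opp x \in flatten ds).
  have : absv x \in map (@absv n) (flatten ds).
    by rewrite -eqds (perm_mem pcs) mem_iota add1n ltnS /absv /= ltn_ord.
  by case/mapP=> y yd /absv_eq[] <-; rewrite yd ?orbT.
have [s sP] := perm_of_cycles Ufull.
have uniq_in d : d \in ds ++ op -> uniq d.
  move=> dd; rewrite -(map_id d); apply: (map_uniq_flatten (f := id)) dd.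
  by rewrite map_id.
have sin d : d \in ds -> {in d, s =1 next d}.
  by move=> dd; apply: sP; rewrite mem_cat dd.
have sin_op d : d \in ds -> {in map (@opp n) d, s =1 next (map (@opp n) d)}.
  by move=> dd; apply: sP; rewrite mem_cat /op map_f ?orbT.
have uniq_d d : d \in ds -> uniq d by move=> dd; apply: uniq_in; rewrite mem_cat dd.
have signed_d d x : d \in ds -> x \in d -> s (opp x) = opp (s x).
  move=> dd xd; rewrite (sin d dd x xd) (sin_op d dd) ?map_f //.
  by rewrite (next_map (inv_inj (@oppK n))) // uniq_d.
have signed : signed_perm s.
  move=> x; case/orP: (cover x) => /flattenP[d dd xd]; first exact: signed_d xd.
  by rewrite -{2}[x]oppK (signed_d d (opp x)) // oppK.
have porbit_d d x : d \in ds -> x \in d -> porbit s x =i d.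
  by move=> dd; apply: porbit_cycle; [exact: uniq_d | exact: sin].
(* The orbit of a letter of [ds] is its list, free of opposite letters; for the remaining letters,
   negate. *)
have opp_porbit x : opp x \notin porbit s x.
  suff opp_d z : z \in flatten ds -> opp z \notin porbit s z.
    case/orP: (cover x) => /opp_d //; rewrite oppK; apply: contra => oxx.
    by rewrite -{1}[x]oppK porbit_opp.
  case/flattenP=> d dd zd; rewrite (porbit_d d) //; apply/negP => ozd.
  have /oppNds/negP[] : z \in flatten ds by apply/flattenP; exists d.
  by apply/flattenP; exists d.
have headP d : d \in ds -> exists a w, [/\ d = a :: w, ~~ a.1 &
    {in d, forall x, absv a <= absv x}].
  move=> dd; have := allP ccs (map (@code n) d); rewrite -eqcs map_f // => /(_ isT).
  case: d {dd} => // a w /= /and3P[]; rewrite odd_code => a1 aw _; exists a, w; split=> //.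
  move=> x; rewrite inE => /predU1P[->//|xw].
  have /ltnW/half_leq := allP aw _ (map_f (@code n) xw).
  by rewrite !half_code.
(* Default letter for [head], available because [n] is positive. *)
have x0 : pm n := pos (Ordinal n0).
have mem_heads : leaders s =i map (head x0) ds.
  move=> x; rewrite mem_leaders.
  apply/andP/mapP => [[x1 /forall_inP xmin]|[d dd ->]]; last first.
    have [a [w [ed a1 amin]]] := headP d dd; rewrite [head _ _](_ : _ = a) ?ed //.
    split=> //; apply/forall_inP => y; rewrite (porbit_d d) ?ed ?mem_head //.
      by rewrite -ed; exact: amin.
    by rewrite -ed.
  have [d dd xd] : exists2 d, d \in ds & (x \in d) || (opp x \in d).
    by case/orP: (cover x) => /flattenP[d dd xd]; exists d; rewrite ?xd ?orbT.
  have [a [w [ed a1 amin]]] := headP d dd; exists d; rewrite // ed /=.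
  have ad : a \in d by rewrite ed mem_head.
  apply: pos_absv_inj => //; apply/eqP; rewrite eqn_leq.
  (* Minimality of [x] and of the head [a] bounds each absolute value by the other, through [opp x]
     and [opp a] when [d] contains [opp x]. *)
  case/orP: xd => xd; first by rewrite amin // xmin // (porbit_d d).
  rewrite (amin _ xd) (xmin (opp a)) // -[x]oppK porbit_opp //.
  by rewrite (porbit_d d).
have eql : leaders s = map (head x0) ds.
  apply: (inj_map (@code_inj n)).
  (* Two strictly sorted lists with the same elements are equal. *)
  apply: (irr_sorted_eq ltn_trans ltnn (sorted_code_leaders s)).
    suff -> : map (@code n) (map (head x0) ds) = map (head 0) cs by [].
    rewrite -eqcs -!map_comp; apply/eq_in_map => d /headP[a [w [-> _ _]]] //.
  exact: eq_mem_map.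
have eqn : cycle_notation s = ds.
  rewrite /cycle_notation eql -map_comp -[RHS]map_id; apply/eq_in_map => d dd /=.
  have [a [w [ed _ _]]] := headP d dd; rewrite ed /=.
  by apply: traject_cycle; rewrite -ed; [exact: uniq_d | exact: sin].
exists s; last by rewrite /codes eqn.
split=> //.
  move=> _ /imsetP[x _ ->] eqC; have /negP[] := opp_porbit x.
  by rewrite -eqC imset_f ?porbit_id.
move=> c; rewrite eqn => cd; apply/up_down_code; first exact: map_uniq_flatten cd.
have := allP ccs (map (@code n) c); rewrite -eqcs map_f // => /(_ isT).
case: c {cd} => // a w /= /and3P[_ aw altw].
by rewrite -[alt_path _ _ _]/(alt false (_ :: _)) alt_min // altw orbT.
Qed.
End Codes.

(** * The rightmost label and the bijection *)

Lemma rightmost_label n (s : {perm pm n}) k : 0 < k ->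
  let p := rightmost_path (forest (codes s)) in
  nth None p (size p).-2 = Some k <-> last 0 (map (@absv n) (leaders s)) = k.
Proof.
move=> k0 /=; rewrite rightmost_path_forest size_rcons size_map /=.
have -> : [seq Some (head 0 c)./2 | c <- codes s] =
    map Some (map (@absv n) (leaders s)).
  have <- : map half (map (head 0) (codes s)) = map (@absv n) (leaders s).
    by rewrite heads_codes -map_comp; apply: eq_map => x /=; rewrite half_code.
  by rewrite -!map_comp.
have -> : size (codes s) = size (map (@absv n) (leaders s)) by rewrite !size_map.
case/lastP: (map (@absv n) _) => [|a x].
  (* Without cycles both sides fail: the path is a lone empty leaf, and the default 0 differs from
     the positive [k]. *)
  by split=> // k_eq; rewrite -k_eq in k0.
rewrite size_rcons last_rcons nth_rcons size_map size_rcons leqnn.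
rewrite (nth_map 0) ?size_rcons // nth_rcons ltnn eqxx.
by split=> [[]|->].
Qed.

Theorem theorem5p2 (n : nat) (hn : 1 <= n) :
  exists phi : {perm pm n} -> tree,
    set_bij (@CUDB n) (Tcirc n) phi /\
    forall k : nat, 1 <= k <= n ->
      set_bij (@CUDBk n k) (Tcirck n k) phi.
Proof.
pose phi (s : {perm pm n}) := forest (codes s).
have phiT s : CUDB s -> Tcirc n (phi s).
  move=> sC; have vs := cycle_list_codes sC.
  split; last by rewrite /phi rightmost_path_forest last_rcons.
  apply/mem_Tn; split; last exact: increasing_forest.
  rewrite (permPl (labels_forest vs)).
  by case: sC => signed nopp _; exact: perm_codes.
have phi_inj : {in @CUDB n &, injective phi}.
  move=> s t; rewrite !inE => sC tC eq_phi; apply: codes_inj => //.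
  by apply: forest_inj eq_phi; exact: cycle_list_codes.
have phi_surj t : Tcirc n t -> exists2 s, CUDB s & phi s = t.
  case=> /mem_Tn[pt it] lt.
  have [|cs vcs ft] := forest_surj it _ lt.
    by rewrite (perm_uniq pt) iota_uniq.
  have [|s sC es] := codes_surj hn vcs.
    by rewrite -(permPl (labels_forest vcs)) ft.
  by exists s; rewrite // /phi es.
exists phi; split; first by split.
(* [phi] carries the last leader to the rightmost label, so the refined bijections are restrictions
   of the full one. *)
move=> k /andP[k0 _]; split.
- by move=> s [sC sk]; split; [exact: phiT | exact/rightmost_label].
- move=> s t; rewrite !inE => -[sC _] [tC _].
  by apply: phi_inj; rewrite inE.
move=> t [/phi_surj[s sC <-] tk]; exists s => //; split=> //.
exact/rightmost_label.
Qed.
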